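(* Let $G$ be a graph of order $n$ and $\ell$ a positive integer. (1) If some first-order sentence with at most $\ell$ variables distinguishes $G$ from a graph $H$, then $D^{\ell}(G,H)\le n^{\ell-1}+\ell-2$. (2) If $G$ is definable by a first-order sentence with at most $\ell$ variables, then $D^{\ell}(G)\le n^{\ell-1}+\ell-2$.
   Context: Graphs are finite, simple, undirected, with non-empty vertex set; the order is the number of vertices. First-order sentences about graphs use variables ranging over vertices, relations $\sim$ (adjacency) and $=$, Boolean connectives, quantifiers $\exists,\forall$; the quantifier depth is the maximum length of a chain of nested quantifiers. A sentence distinguishes $G$ from $H$ if it is true on $G$ and false on $H$; it defines $G$ if it distinguishes $G$ from every graph not isomorphic to $G$. $D^{\ell}(G,H)$ (resp. $D^\ell(G)$) is the minimum quantifier depth of a sentence using at most $\ell$ distinct variable symbols (variables may be reused) distinguishing $G$ from $H$ (resp. defining $G$).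
   Formalization: The case n = 1, ℓ = 2 is excluded: there the bound is 1, but K_1 is defined by ∀x∀y (x = y) with two variables and no sentence of quantifier depth 1 distinguishes K_1 from K_2, so both parts fail as stated. *)

(* Defs.v *)
From mathcomp Require Import all_boot.

Set Implicit Arguments.
Unset Strict Implicit.
Unset Printing Implicit Defensive.

Record graph := Graph {
  vertex :> finType;
  adj : rel vertex;
  adj_sym : symmetric adj;
  adj_irr : irreflexive adj;
  vertex_gt0 : 0 < #|vertex|
}.

Definition isomorphic (G H : graph) : Prop :=
  exists2 f : G -> H, bijective f & forall x y, adj (f x) (f y) = adj x y.

Inductive formula :=
  | Adj of nat & nat
  | Eq of nat & nat
  | Not of formula
  | And of formula & formula
  | Or of formula & formula
  | Imp of formula & formula
  | Ex of nat & formula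
  | All of nat & formula.

Fixpoint sat (G : graph) (e : nat -> G) (phi : formula) : bool :=
  match phi with
  | Adj x y => adj (e x) (e y)
  | Eq x y => e x == e y
  | Not p => ~~ sat e p
  | And p q => sat e p && sat e q
  | Or p q => sat e p || sat e q
  | Imp p q => sat e p ==> sat e q
  | Ex x p => [exists v : G, sat [eta e with x |-> v] p]
  | All x p => [forall v : G, sat [eta e with x |-> v] p]
  end.

Fixpoint free_vars (phi : formula) : seq nat :=
  match phi with
  | Adj x y | Eq x y => [:: x; y]
  | Not p => free_vars p
  | And p q | Or p q | Imp p q => free_vars p ++ free_vars q
  | Ex x p | All x p => [seq y <- free_vars p | y != x]
  end.

Definition sentence (phi : formula) : Prop := free_vars phi = [::].

Fixpoint vars (phi : formula) : seq nat :=
  match phi with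
  | Adj x y | Eq x y => [:: x; y]
  | Not p => vars p
  | And p q | Or p q | Imp p q => vars p ++ vars q
  | Ex x p | All x p => x :: vars p
  end.

Definition nvars (phi : formula) : nat := size (undup (vars phi)).

Fixpoint qdepth (phi : formula) : nat :=
  match phi with
  | Adj _ _ | Eq _ _ => 0
  | Not p => qdepth p
  | And p q | Or p q | Imp p q => maxn (qdepth p) (qdepth q)
  | Ex _ p | All _ p => (qdepth p).+1
  end.

(* Vertex sets are non-empty, so for a sentence quantifying over all the
   assignments amounts to evaluating it under any one of them. *)
Definition true_on (G : graph) (phi : formula) : Prop :=
  forall e : nat -> G, sat e phi.

Definition distinguishes (phi : formula) (G H : graph) : Prop :=
  true_on G phi /\ ~ true_on H phi.

Definition defines (phi : formula) (G : graph) : Prop :=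
  forall H : graph, ~ isomorphic G H -> distinguishes phi G H.

Definition l_sentence (l : nat) (phi : formula) : Prop :=
  sentence phi /\ nvars phi <= l.

Definition distinguishable (l : nat) (G H : graph) : Prop :=
  exists2 phi, l_sentence l phi & distinguishes phi G H.

Definition definable (l : nat) (G : graph) : Prop :=
  exists2 phi, l_sentence l phi & defines phi G.

Definition is_min_qdepth (P : formula -> Prop) (d : nat) : Prop :=
  (exists2 phi, P phi & qdepth phi = d) /\
  (forall phi, P phi -> d <= qdepth phi).

(* [D_dist l G H d] and [D_def l G d] say that the minimum D^l(G,H), resp.
   D^l(G), exists and equals d. *)
Definition D_dist (l : nat) (G H : graph) : nat -> Prop :=
  is_min_qdepth (fun phi => l_sentence l phi /\ distinguishes phi G H).

Definition D_def (l : nat) (G : graph) : nat -> Prop :=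
  is_min_qdepth (fun phi => l_sentence l phi /\ defines phi G).

(* Pitfall: D^2(K_1) = 2 and D^2(K_1,H) = 2 for every H of order at least 2
   (a sentence of depth 1 only sees x = x and x ~ x), while
   n ^ (l - 1) + l - 2 = 1 when n = 1 and l = 2: the upper bound fails for
   this one pair (n, l), which has to be excluded. *)

(* Main.v *)
(** Put [k = l - 1] and consider the [l]-pebble game at the moments when one
    pebble is off the board, so that positions are [k]-tuples.  The rank [r]
    types of the [k]-tuples of [G] get finer with [r], and they stop changing at
    some [R <= n^k - 2]: if [k >= 2] there are already two types at rank [0], and
    if [k = 1] a minimal module with at least two vertices never splits, so there
    are at most [n - 1] types.  The sentence saying that every [k]-tuple has the
    rank [R + 1] type of some tuple of [G] has depth [k + R + 1], and in a graph
    [H] satisfying it rank [R] equivalence to tuples of [G] is a bisimulation,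
    so [H] satisfies the same [l]-variable sentences as [G].  The graph [K_1] is
    defined by [forall x y, x = y]. *)

Require Import Defs.
From mathcomp Require Import all_boot all_fingroup.
From Stdlib Require Import Classical.

Set Implicit Arguments.
Unset Strict Implicit.
Unset Printing Implicit Defensive.

(** * Existence of minimal depths, and dependence on free variables *)

(** [P] is an arbitrary proposition, so each step of the descent on depth asks [classic] whether a
    shallower formula satisfies it. *)
Lemma is_min_qdepth_ex (P : formula -> Prop) phi :
  P phi -> exists2 d, is_min_qdepth P d & d <= qdepth phi.
Proof.
have [m le_m] := ubnP (qdepth phi); elim: m phi le_m => // m IHm phi le_m Pphi.
have [[psi [Ppsi lt_psi]]|no_psi] :=
  classic (exists psi, P psi /\ qdepth psi < qdepth phi).
  have [|//|d dP le_d] := IHm psi; first exact: leq_trans lt_psi le_m.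
  by exists d => //; apply: leq_trans le_d (ltnW lt_psi).
exists (qdepth phi) => //; split=> [|psi Ppsi]; first by exists phi.
by rewrite leqNgt; apply/negP => lt_psi; case: no_psi; exists psi.
Qed.

Lemma sat_free_vars (A : graph) (e e' : nat -> A) phi :
  {in free_vars phi, e =1 e'} -> sat e phi = sat e' phi.
Proof.
elim: phi e e' => [x y|x y|p IHp|p IHp q IHq|p IHp q IHq|p IHp q IHq|x p IHp|x p IHp]
  e e' /= ee';
  try by rewrite !ee' ?inE ?eqxx ?orbT.
- by rewrite (IHp e e').
- by rewrite (IHp e e') ?(IHq e e') // => y yq; apply: ee'; rewrite mem_cat yq ?orbT.
- by rewrite (IHp e e') ?(IHq e e') // => y yq; apply: ee'; rewrite mem_cat yq ?orbT.
- by rewrite (IHp e e') ?(IHq e e') // => y yq; apply: ee'; rewrite mem_cat yq ?orbT.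
- apply: eq_existsb => v; apply: IHp => y yp /=; case: eqP => // /eqP yx.
  by apply: ee'; rewrite mem_filter yx.
- apply: eq_forallb => v; apply: IHp => y yp /=; case: eqP => // /eqP yx.
  by apply: ee'; rewrite mem_filter yx.
Qed.

Lemma free_vars_sub phi : {subset free_vars phi <= vars phi}.
Proof.
elim: phi => [x y|x y|p IHp|p IHp q IHq|p IHp q IHq|p IHp q IHq|x p IHp|x p IHp] z //=;
  rewrite ?mem_cat ?mem_filter ?inE; try by case/orP => [/IHp->|/IHq->]; rewrite ?orbT.
- exact: IHp.
- by case/andP => _ /IHp ->; rewrite orbT.
- by case/andP => _ /IHp ->; rewrite orbT.
Qed.

(** * Conjunctions, disjunctions and closures *)

(* There are no constants for truth and falsity; the variable [z] supplies the
   trivial atom [z = z]. *)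
Definition conj z (s : seq formula) := foldr And (Eq z z) s.
Definition disj z (s : seq formula) := foldr Or (Not (Eq z z)) s.
Definition close (s : seq nat) phi := foldr All phi s.

Section Connectives.
Variables (T : finType) (z : nat) (f : T -> formula).

Lemma sat_conj (A : graph) (e : nat -> A) :
  sat e (conj z [seq f x | x <- enum T]) = [forall x, sat e (f x)].
Proof.
transitivity (all (fun x => sat e (f x)) (enum T)).
  by elim: (enum T) => [|x s /= ->] //=; rewrite eqxx.
by apply/allP/forallP => [h x|h x _]; rewrite ?h ?mem_enum.
Qed.

Lemma sat_disj (A : graph) (e : nat -> A) :
  sat e (disj z [seq f x | x <- enum T]) = [exists x, sat e (f x)].
Proof.
transitivity (has (fun x => sat e (f x)) (enum T)).
  by elim: (enum T) => [|x s /= ->] //=; rewrite eqxx.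
apply/hasP/existsP => [[x _ h]|[x h]]; first by exists x.
by exists x; rewrite ?mem_enum.
Qed.

Section Vars.
Variable P : pred nat.
Hypothesis Pz : P z.

Lemma all_vars_conj :
  (forall x, all P (vars (f x))) -> all P (vars (conj z [seq f x | x <- enum T])).
Proof.
by move=> h; elim: (enum T) => [|x s IHs] /=; rewrite ?Pz // all_cat h.
Qed.

Lemma all_vars_disj :
  (forall x, all P (vars (f x))) -> all P (vars (disj z [seq f x | x <- enum T])).
Proof.
by move=> h; elim: (enum T) => [|x s IHs] /=; rewrite ?Pz // all_cat h.
Qed.

Lemma all_free_vars_conj :
  (forall x, all P (free_vars (f x))) ->
  all P (free_vars (conj z [seq f x | x <- enum T])).
Proof.
by move=> h; elim: (enum T) => [|x s IHs] /=; rewrite ?Pz // all_cat h.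
Qed.

Lemma all_free_vars_disj :
  (forall x, all P (free_vars (f x))) ->
  all P (free_vars (disj z [seq f x | x <- enum T])).
Proof.
by move=> h; elim: (enum T) => [|x s IHs] /=; rewrite ?Pz // all_cat h.
Qed.

End Vars.

Lemma qdepth_conj m :
  (forall x, qdepth (f x) <= m) -> qdepth (conj z [seq f x | x <- enum T]) <= m.
Proof. by move=> h; elim: (enum T) => [|x s IHs] //=; rewrite geq_max h. Qed.

Lemma qdepth_disj m :
  (forall x, qdepth (f x) <= m) -> qdepth (disj z [seq f x | x <- enum T]) <= m.
Proof. by move=> h; elim: (enum T) => [|x s IHs] //=; rewrite geq_max h. Qed.

End Connectives.

Lemma true_on_close (A : graph) s phi :
  true_on A (close s phi) <-> true_on A phi.
Proof.
elim: s => //= x s IHs; split=> [h|/IHs h e]; last by apply/forallP => v; apply: h.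
(* Instantiating [x] at its current value [e x] leaves the assignment pointwise unchanged. *)
apply/IHs => e; have /forallP /(_ (e x)) := h e; apply: etrans.
by apply: sat_free_vars => y _ /=; case: eqP => [->|].
Qed.

Lemma free_vars_close s phi :
  free_vars (close s phi) = [seq y <- free_vars phi | y \notin s].
Proof.
elim: s => [|x s IHs] /=; first by rewrite filter_predT.
by rewrite IHs -filter_predI; apply: eq_filter => y /=; rewrite inE negb_or.
Qed.

Lemma vars_close s phi : vars (close s phi) = s ++ vars phi.
Proof. by elim: s => //= x s ->. Qed.

Lemma qdepth_close s phi : qdepth (close s phi) = size s + qdepth phi.
Proof. by elim: s => //= x s ->. Qed.

(** * Pebble equivalence *)

Section Update.
Variable l : nat.

Definition update (A : graph) (e : {ffun 'I_l -> A}) i a : {ffun 'I_l -> A} :=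
  [ffun j => if j == i then a else e j].

Definition permute (A : graph) (s : {perm 'I_l}) (e : {ffun 'I_l -> A}) :
    {ffun 'I_l -> A} :=
  [ffun j => e (s j)].

Lemma permute_update (A : graph) (s : {perm 'I_l}) (e : {ffun 'I_l -> A}) i a :
  permute s (update e (s i) a) = update (permute s e) i a.
Proof. by apply/ffunP => j; rewrite !ffunE (inj_eq perm_inj). Qed.

Lemma permuteK (A : graph) i j : involutive (@permute A (tperm i j)).
Proof. by move=> e; apply/ffunP => p; rewrite !ffunE tpermK. Qed.

End Update.

Section Agree.
Variable l : nat.

(** On the pebbles in [D], matching [e p] with [e' p] is a partial isomorphism between [A] and
    [B]. *)
Definition agree (D : {pred 'I_l}) (A B : graph)
    (e : {ffun 'I_l -> A}) (e' : {ffun 'I_l -> B}) :=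
  [forall p, forall q, (p \in D) && (q \in D) ==>
    ((adj (e p) (e q) == adj (e' p) (e' q)) && ((e p == e q) == (e' p == e' q)))].

Lemma agreeP (D : {pred 'I_l}) (A B : graph)
    (e : {ffun 'I_l -> A}) (e' : {ffun 'I_l -> B}) :
  reflect (forall p q, p \in D -> q \in D ->
             adj (e p) (e q) = adj (e' p) (e' q) /\ (e p == e q) = (e' p == e' q))
          (agree D e e').
Proof.
apply: (iffP forallP) => [h p q pD qD|h p].
  by have /forallP /(_ q) := h p; rewrite pD qD => /andP[/eqP -> /eqP ->].
by apply/forallP => q; apply/implyP => /andP[pD qD]; have [-> ->] := h p q pD qD; rewrite !eqxx.
Qed.

Lemma agree_refl D (A : graph) (e : {ffun 'I_l -> A}) : agree D e e.
Proof. exact/agreeP. Qed.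

Lemma agree_sym D (A B : graph) (e : {ffun 'I_l -> A}) (e' : {ffun 'I_l -> B}) :
  agree D e e' = agree D e' e.
Proof. by apply/agreeP/agreeP => h p q pD qD; have [-> ->] := h p q pD qD. Qed.

Lemma agree_trans D (A B C : graph) (e : {ffun 'I_l -> A}) (e' : {ffun 'I_l -> B})
    (e'' : {ffun 'I_l -> C}) :
  agree D e e' -> agree D e' e'' -> agree D e e''.
Proof.
move=> /agreeP h /agreeP h'; apply/agreeP => p q pD qD.
by have [-> ->] := h p q pD qD; apply: h'.
Qed.

Lemma agree_permute (D D' : {pred 'I_l}) (s : {perm 'I_l}) (A B : graph)
    (e : {ffun 'I_l -> A}) (e' : {ffun 'I_l -> B}) :
  (forall j, j \in D' -> s j \in D) ->
  agree D e e' -> agree D' (permute s e) (permute s e').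
Proof.
move=> sD /agreeP h; apply/agreeP => p q pD qD; rewrite !ffunE.
by apply: h; apply: sD.
Qed.

End Agree.

Section PebbleEquiv.
Variable l : nat.

(* [peq r i e e']: Duplicator survives [r] more rounds of the [l]-pebble game
   when pebble [i] is off the board, so the [i]-th coordinates are junk. *)
Fixpoint peq r (A B : graph) i (e : {ffun 'I_l -> A}) (e' : {ffun 'I_l -> B}) :=
  agree (predC1 i) e e' &&
  if r isn't r'.+1 then true else
    let good a b :=
      agree predT (update e i a) (update e' i b) &&
      [forall j, peq r' j (update e i a) (update e' i b)] in
    [forall a, exists b, good a b] && [forall b, exists a, good a b].

(** The position with all [l] pebbles on the board, before Spoiler picks the pebble [j] to lift; it
    names the condition [good] inside [peq]. *)
Definition peq_all r (A B : graph) (e : {ffun 'I_l -> A}) (e' : {ffun 'I_l -> B}) :=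
  agree predT e e' && [forall j, peq r j e e'].

Lemma peqSP r (A B : graph) i (e : {ffun 'I_l -> A}) (e' : {ffun 'I_l -> B}) :
  reflect [/\ agree (predC1 i) e e',
              forall a, exists b, peq_all r (update e i a) (update e' i b) &
              forall b, exists a, peq_all r (update e i a) (update e' i b)]
          (peq r.+1 i e e').
Proof.
apply: (iffP and3P) => -[h f g]; split=> //.
- by move=> a; apply/existsP; apply: (forallP f).
- by move=> b; apply/existsP; apply: (forallP g).
- by apply/forallP => a; apply/existsP/f.
- by apply/forallP => b; apply/existsP/g.
Qed.

Lemma peq_agree r (A B : graph) i (e : {ffun 'I_l -> A}) (e' : {ffun 'I_l -> B}) :
  peq r i e e' -> agree (predC1 i) e e'.
Proof. by case: r => [|r] /andP[]. Qed.

Lemma peq0E (A B : graph) i (e : {ffun 'I_l -> A}) (e' : {ffun 'I_l -> B}) :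
  peq 0 i e e' = agree (predC1 i) e e'.
Proof. exact: andbT. Qed.

Lemma peqS_peq r (A B : graph) i (e : {ffun 'I_l -> A}) (e' : {ffun 'I_l -> B}) :
  peq r.+1 i e e' -> peq r i e e'.
Proof.
elim: r i e e' => [|r IHr] i e e'; first by move/peq_agree; rewrite peq0E.
have sub w w' : @peq_all r.+1 A B w w' -> @peq_all r A B w w'.
  by case/andP=> h /forallP hj; rewrite /peq_all h; apply/forallP => j; apply: IHr.
case/peqSP=> h f g; apply/peqSP; split=> // [a|b].
  by have [b hb] := f a; exists b; apply: sub.
by have [a ha] := g b; exists a; apply: sub.
Qed.

Lemma peq_refl r (A : graph) i (e : {ffun 'I_l -> A}) : peq r i e e.
Proof.
elim: r i e => [|r IHr] i e; first by rewrite peq0E agree_refl.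
apply/peqSP; split=> [|a|a]; first exact: agree_refl.
all: by exists a; rewrite /peq_all agree_refl; apply/forallP.
Qed.

Lemma peq_sym r (A B : graph) i (e : {ffun 'I_l -> A}) (e' : {ffun 'I_l -> B}) :
  peq r i e e' -> peq r i e' e.
Proof.
elim: r A B i e e' => [|r IHr] A B i e e'; first by rewrite !peq0E agree_sym.
have sub w w' : @peq_all r A B w w' -> @peq_all r B A w' w.
  by case/andP=> h /forallP hj; rewrite /peq_all agree_sym h; apply/forallP => j; apply: IHr.
case/peqSP=> h f g; apply/peqSP; split=> [|b|a]; first by rewrite agree_sym.
  by have [a ha] := g b; exists a; apply: sub.
by have [b hb] := f a; exists b; apply: sub.
Qed.

Lemma peq_trans r (A B C : graph) i (e : {ffun 'I_l -> A}) (e' : {ffun 'I_l -> B})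
    (e'' : {ffun 'I_l -> C}) :
  peq r i e e' -> peq r i e' e'' -> peq r i e e''.
Proof.
elim: r i e e' e'' => [|r IHr] i e e' e''; first by rewrite !peq0E; apply: agree_trans.
have sub w (w' : {ffun 'I_l -> B}) (w'' : {ffun 'I_l -> C}) :
    peq_all r w w' -> peq_all r w' w'' -> @peq_all r A C w w''.
  case/andP=> h /forallP hj /andP[h' /forallP hj']; rewrite /peq_all (agree_trans h h').
  by apply/forallP => j; apply: IHr (hj j) (hj' j).
case/peqSP=> h f g /peqSP[h' f' g']; apply/peqSP; split=> [|a|c].
- exact: agree_trans h h'.
- by have [b hb] := f a; have [c hc] := f' b; exists c; apply: sub hb hc.
- by have [b hb] := g' c; have [a ha] := g b; exists a; apply: sub ha hb.
Qed.

(** Relabelling pebbles is a symmetry of the game; transpositions will move the free slot between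
    [i] and [ord_max]. *)
Lemma peq_permute r (A B : graph) (s : {perm 'I_l}) i
    (e : {ffun 'I_l -> A}) (e' : {ffun 'I_l -> B}) :
  peq r (s i) e e' -> peq r i (permute s e) (permute s e').
Proof.
have sD j k : k \in predC1 j -> s k \in predC1 (s j).
  by rewrite !inE (inj_eq perm_inj).
elim: r i e e' => [|r IHr] i e e'; first by rewrite !peq0E; apply: agree_permute (sD i).
have sub w w' : @peq_all r A B w w' -> @peq_all r A B (permute s w) (permute s w').
  case/andP=> h /forallP hj; rewrite /peq_all (agree_permute _ h) //.
  by apply/forallP => j; apply: IHr.
case/peqSP=> h f g; apply/peqSP; split=> [|a|b]; first exact: agree_permute (sD i) h.
  by have [b /sub] := f a; rewrite !permute_update; exists b.
by have [a /sub] := g b; rewrite !permute_update; exists a.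
Qed.

(** The next move overwrites coordinate [i], so both tuples have the same successors and Duplicator
    copies. *)
Lemma peq_update r (A : graph) i (e : {ffun 'I_l -> A}) a : peq r i (update e i a) e.
Proof.
have upd2 b : update (update e i a) i b = update e i b.
  by apply/ffunP => j; rewrite !ffunE; case: eqP.
have h : agree (predC1 i) (update e i a) e.
  by apply/agreeP => p q; rewrite !inE !ffunE => /negPf -> /negPf ->.
case: r => [|r]; first by rewrite peq0E.
by apply/peqSP; split=> // b; exists b; rewrite upd2 /peq_all agree_refl;
  apply/forallP => j; apply: peq_refl.
Qed.

End PebbleEquiv.

(** * Bisimulations preserve formulas *)

Section Bisimulation.
Variables (l : nat) (A B : graph).
Variable Bis : {ffun 'I_l -> A} -> {ffun 'I_l -> B} -> Prop.
Hypothesis Bis_agree : forall w w', Bis w w' -> agree predT w w'.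
Hypothesis Bis_forth :
  forall w w' i a, Bis w w' -> exists b, Bis (update w i a) (update w' i b).
Hypothesis Bis_back :
  forall w w' i b, Bis w w' -> exists a, Bis (update w i a) (update w' i b).

(** Each variable [x] of [V] owns the pebble [rho x], and a quantifier over [x] moves that pebble.
    Reusing a variable just overwrites the old place of its pebble. *)
Lemma bisimilar_sat (V : seq nat) (rho : nat -> 'I_l) phi e e' w w' :
  {in V &, injective rho} -> {subset vars phi <= V} -> Bis w w' ->
  {in V, forall x, e x = w (rho x)} -> {in V, forall x, e' x = w' (rho x)} ->
  sat e phi = sat e' phi.
Proof.
move=> rho_inj.
elim: phi e e' w w' => [x y|x y|p IHp|p IHp q IHq|p IHp q IHq|p IHp q IHq|x p IHp|x p IHp]
  e e' w w' /= sV bis eV e'V.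
- have [xV yV] : x \in V /\ y \in V by split; apply: sV; rewrite !inE eqxx ?orbT.
  by rewrite !eV ?e'V //; case: (agreeP _ _ _ (Bis_agree bis) (rho x) (rho y)).
- have [xV yV] : x \in V /\ y \in V by split; apply: sV; rewrite !inE eqxx ?orbT.
  by rewrite !eV ?e'V //; case: (agreeP _ _ _ (Bis_agree bis) (rho x) (rho y)).
- by rewrite (IHp e e' w w').
- by rewrite (IHp e e' w w') ?(IHq e e' w w') // => y yq; apply: sV; rewrite mem_cat yq ?orbT.
- by rewrite (IHp e e' w w') ?(IHq e e' w w') // => y yq; apply: sV; rewrite mem_cat yq ?orbT.
- by rewrite (IHp e e' w w') ?(IHq e e' w w') // => y yq; apply: sV; rewrite mem_cat yq ?orbT.
all: have xV : x \in V by apply: sV; rewrite inE eqxx.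
all: have pV : {subset vars p <= V} by move=> y yp; apply: sV; rewrite inE yp orbT.
all: have upd (C : graph) (f : nat -> C) (u : {ffun 'I_l -> C}) c :
    {in V, forall y, f y = u (rho y)} ->
    {in V, forall y, [eta f with x |-> c] y = update u (rho x) c (rho y)}
  by move=> fV y yV; rewrite /= ffunE (inj_in_eq rho_inj) //; case: eqP => // _; apply: fV.
all: have IH a b : Bis (update w (rho x) a) (update w' (rho x) b) ->
    sat [eta e with x |-> a] p = sat [eta e' with x |-> b] p
  by move=> h; apply: (IHp _ _ _ _ pV h); apply: upd.
- apply/existsP/existsP => -[a ha].
    by have [b /IH hb] := Bis_forth (rho x) a bis; exists b; rewrite -hb.
  by have [b /IH hb] := Bis_back (rho x) a bis; exists b; rewrite hb.
- apply/forallP/forallP => h a.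
    by have [b /IH hb] := Bis_back (rho x) a bis; rewrite -hb.
  by have [b /IH hb] := Bis_forth (rho x) a bis; rewrite hb.
Qed.

Lemma bisimilar_true_on w w' phi :
  0 < l -> Bis w w' -> l_sentence l phi -> true_on A phi -> true_on B phi.
Proof.
move=> l_gt0 bis [closed le_l] Aphi e'.
(* The default of [insubd] is never taken on [V], whose size is at most [l]. *)
pose V := undup (vars phi); pose rho x : 'I_l := insubd (Ordinal l_gt0) (index x V).
have rhoE x : x \in V -> rho x = index x V :> nat.
  by move=> xV; rewrite /rho val_insubd (leq_trans _ le_l) // index_mem.
have rho_inj : {in V &, injective rho}.
  move=> x y xV yV eq_rho; apply: (index_inj x xV yV).
  by rewrite -!rhoE ?eq_rho.
(* A sentence ignores its assignment, so [e'] may be replaced by one read off [w']. *)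
rewrite (sat_free_vars (e' := fun x => w' (rho x))); last by rewrite closed.
rewrite -(@bisimilar_sat V rho phi (fun x => w (rho x)) _ w w') //.
by move=> x; rewrite mem_undup.
Qed.

End Bisimulation.

Lemma isomorphic_true_on l (A B : graph) phi : 0 < l ->
  isomorphic A B -> l_sentence l phi -> true_on A phi -> true_on B phi.
Proof.
move=> l_gt0 [f [g fK gK] f_adj] lphi.
have /card_gt0P[a _] := vertex_gt0 A.
pose img (w : {ffun 'I_l -> A}) : {ffun 'I_l -> B} := [ffun j => f (w j)].
have img_update w i c : img (update w i c) = update (img w) i (f c).
  by apply/ffunP => j; rewrite !ffunE; case: eqP.
apply: (@bisimilar_true_on l A B (fun w w' => w' = img w) _ _ _ [ffun=> a]) => //.
- move=> w _ ->; apply/agreeP => p q _ _; rewrite !ffunE f_adj; split=> //.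
  by rewrite (can_eq fK).
- by move=> w _ i c ->; exists (f c).
- by move=> w _ i b ->; exists (g b); rewrite img_update gK.
Qed.

(** With one pebble all positions look alike, since the only atoms are [x = x] and [x ~ x]; the full
    relation is a bisimulation. *)
Lemma one_variable_true_on (A B : graph) phi :
  l_sentence 1 phi -> true_on A phi -> true_on B phi.
Proof.
have /card_gt0P[a _] := vertex_gt0 A; have /card_gt0P[b _] := vertex_gt0 B.
apply: (@bisimilar_true_on 1 A B (fun _ _ => True) _ _ _ [ffun=> a] [ffun=> b]) => //.
by move=> w w' _; apply/agreeP => p q _ _; rewrite !ord1 !adj_irr !eqxx.
Qed.

(** * Hintikka formulas *)

Section Hintikka.
Variables (m : nat) (G : graph).
Let l := m.+2.
Implicit Types (e : {ffun 'I_l -> G}) (i : 'I_l).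

(** A variable different from [i], namely 1 for [ord0] and 0 otherwise; it exists because [l >= 2].
    It feeds the trivial atoms without making [i] free. *)
Definition other i : nat := (i == ord0).

Definition literal (b : bool) phi := if b then phi else Not phi.

Definition diagram (D : {pred 'I_l}) z e :=
  conj z [seq conj z
    [seq if (p \in D) && (q \in D)
         then And (literal (adj (e p) (e q)) (Adj p q)) (literal (e p == e q) (Eq p q))
         else Eq z z | q <- enum 'I_l] | p <- enum 'I_l].

(** The two groups under the successor case are the forth and back clauses of [peq]: vertices of [G]
    are enumerated by [conj] and [disj], while those of the other graph are quantified through
    variable [i]. *)
Fixpoint hintikka r i e : formula :=
  And (diagram (predC1 i) (other i) e)
  (if r isn't r'.+1 then Eq (other i) (other i) else
    let good a :=
      And (diagram predT i (update e i a))
          (conj i [seq hintikka r' j (update e i a) | j <- enum 'I_l]) in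
    And (conj (other i) [seq Ex i (good a) | a <- enum G])
        (All i (disj i [seq good a | a <- enum G]))).

Definition tuple_of (H : graph) (e : nat -> H) : {ffun 'I_l -> H} :=
  [ffun j => e (val j)].

Lemma tuple_of_update (H : graph) (e : nat -> H) i v :
  tuple_of [eta e with (val i) |-> v] = update (tuple_of e) i v.
Proof. by apply/ffunP => j; rewrite !ffunE /= (inj_eq val_inj). Qed.

Lemma sat_literal (H : graph) (e : nat -> H) b phi :
  sat e (literal b phi) = (b == sat e phi).
Proof. by case: b => /=; case: (sat e phi). Qed.

Lemma sat_diagram (H : graph) (e' : nat -> H) D z e :
  sat e' (diagram D z e) = agree D e (tuple_of e').
Proof.
rewrite sat_conj; apply: eq_forallb => p; rewrite sat_conj; apply: eq_forallb => q.
by case: ifP => _ /=; rewrite ?eqxx // !sat_literal !ffunE.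
Qed.

Lemma sat_hintikka (H : graph) (e' : nat -> H) r i e :
  sat e' (hintikka r i e) = peq r i e (tuple_of e').
Proof.
elim: r i e e' => [|r IHr] i e e' /=; rewrite sat_diagram ?eqxx //.
have goodE a v :
    sat [eta e' with (val i) |-> v] (And (diagram predT i (update e i a))
      (conj i [seq hintikka r j (update e i a) | j <- enum 'I_l]))
    = peq_all r (update e i a) (update (tuple_of e') i v).
  rewrite /= sat_diagram sat_conj tuple_of_update; congr (_ && _).
  by apply: eq_forallb => j; rewrite IHr tuple_of_update.
congr [&& _, _ & _].
  by rewrite sat_conj; apply: eq_forallb => a; apply: eq_existsb => v; apply: goodE.
by apply: eq_forallb => v; rewrite sat_disj; apply: eq_existsb => a; apply: goodE.
Qed.

Lemma other_neq i : other i != i.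
Proof. by case: i => -[|i] lt_i; rewrite /other. Qed.

Lemma other_lt i : other i < l.
Proof. by rewrite /other; case: eqP. Qed.

Lemma vars_diagram D z e : z < l -> all (ltn^~ l) (vars (diagram D z e)).
Proof.
move=> lt_z; apply: all_vars_conj => // p; apply: all_vars_conj => // q.
by case: ifP => _ /=; rewrite ?lt_z // all_cat;
  case: adj; case: eqP => _ /=; rewrite !ltn_ord.
Qed.

Lemma free_vars_diagram i (z : nat) e : z != i ->
  all (predC1 (i : nat)) (free_vars (diagram (predC1 i) z e)).
Proof.
move=> neq_z; apply: all_free_vars_conj => // p; apply: all_free_vars_conj => // q.
case: ifP => [/andP[]|_] /=; last by rewrite neq_z.
rewrite !inE -!(inj_eq val_inj) => pi qi.
by rewrite all_cat; case: adj; case: (_ == _ :> G) => /=; rewrite ?pi ?qi.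
Qed.

Lemma qdepth_diagram D z e : qdepth (diagram D z e) = 0.
Proof.
apply/eqP; rewrite -leqn0; apply: qdepth_conj => p; apply: qdepth_conj => q.
by case: ifP => //= _; case: adj; case: eqP.
Qed.

Lemma vars_hintikka r i e : all (ltn^~ l) (vars (hintikka r i e)).
Proof.
elim: r i e => [|r IHr] i e /=; rewrite all_cat vars_diagram ?other_lt //=.
  by rewrite other_lt.
have good_lt a : all (ltn^~ l) (vars (And (diagram predT i (update e i a))
      (conj i [seq hintikka r j (update e i a) | j <- enum 'I_l]))).
  by rewrite /= all_cat vars_diagram //=; apply: all_vars_conj => //= j; apply: IHr.
rewrite all_cat /= ltn_ord; apply/and3P; split=> //.
  by apply: all_vars_conj => [|a]; [apply: other_lt | rewrite /= ltn_ord good_lt].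
by apply: all_vars_disj => /=.
Qed.

Lemma free_vars_hintikka r i e : all (predC1 (i : nat)) (free_vars (hintikka r i e)).
Proof.
have filterP s : all (predC1 (i : nat)) [seq y <- s | y != i :> nat] by apply: filter_all.
have diagP := free_vars_diagram e (other_neq i).
case: r => [|r]; rewrite [free_vars _]/= all_cat; apply/andP; split=> //.
  by rewrite /= other_neq.
rewrite all_cat filterP andbT.
by apply: all_free_vars_conj => [|a]; [apply: other_neq | apply: filterP].
Qed.

Lemma qdepth_hintikka r i e : qdepth (hintikka r i e) <= r.
Proof.
elim: r i e => [|r IHr] i e /=; rewrite qdepth_diagram //= max0n.
have good_le a : qdepth (And (diagram predT i (update e i a))
      (conj i [seq hintikka r j (update e i a) | j <- enum 'I_l])) <= r.
  by rewrite /= qdepth_diagram max0n; apply: qdepth_conj.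
rewrite geq_max; apply/andP; split; last by rewrite ltnS; apply: qdepth_disj.
by apply: qdepth_conj => a; apply: good_le.
Qed.

(** Only the first [m.+1] variables are closed: the last one is not free in [hintikka r ord_max e],
    which saves one level of depth. *)
Definition covering r : formula :=
  close (iota 0 m.+1)
    (disj 0 [seq hintikka r ord_max e | e <- enum {ffun 'I_l -> G}]).

Lemma covering_true_on r (H : graph) :
  true_on H (covering r) <->
  forall w : {ffun 'I_l -> H}, exists e, peq r ord_max e w.
Proof.
rewrite /covering true_on_close; split=> [h w|h e'].
  (* The values at [x >= l] do not matter, as [tuple_of] reads only the first [l] variables. *)
  pose e' x := w (inord x).
  have <- : tuple_of e' = w by apply/ffunP => j; rewrite ffunE /e' inord_val.
  by have := h e'; rewrite sat_disj => /existsP[e]; rewrite sat_hintikka; exists e.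
rewrite sat_disj; have [e he] := h (tuple_of e').
by apply/existsP; exists e; rewrite sat_hintikka.
Qed.

Lemma covering_l_sentence r : l_sentence l (covering r).
Proof.
pose phi := disj 0 [seq hintikka r ord_max e | e <- enum {ffun 'I_l -> G}].
have lt_phi : all (ltn^~ l) (vars phi).
  by apply: all_vars_disj => // e; apply: vars_hintikka.
have neq_phi : all (predC1 m.+1) (free_vars phi).
  by apply: all_free_vars_disj => // e; apply: (free_vars_hintikka r ord_max).
split; rewrite /sentence /nvars /covering.
  rewrite free_vars_close; apply/eqP; rewrite -[_ == _]negbK -has_filter.
  apply/hasPn => y yphi; rewrite negbK mem_iota /= add0n.
  have /= neq_y := allP neq_phi _ yphi.
  have : y < m.+2 by apply: (allP lt_phi); apply: free_vars_sub.
  by rewrite ltnS leq_eqVlt (negPf neq_y).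
rewrite -[X in _ <= X](size_iota 0 l); apply: uniq_leq_size (undup_uniq _) _ => y.
rewrite mem_undup vars_close mem_cat !mem_iota !add0n.
by case/orP=> [/ltnW//|/(allP lt_phi)].
Qed.

Lemma qdepth_covering r : qdepth (covering r) <= m.+1 + r.
Proof.
by rewrite qdepth_close size_iota leq_add2l; apply: qdepth_disj => e; apply: qdepth_hintikka.
Qed.

(* Stability on [G] makes the rank [r] classes of a covered [H] stable as well. *)
Lemma covering_elementary r (H : graph) phi :
  (forall e e' : {ffun 'I_l -> G}, peq r ord_max e e' -> peq r.+1 ord_max e e') ->
  true_on H (covering r.+1) -> l_sentence l phi -> true_on G phi -> true_on H phi.
Proof.
move=> stable /covering_true_on cov lphi.
have lift_max (e : {ffun 'I_l -> G}) (w : {ffun 'I_l -> H}) :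
    peq r ord_max e w -> peq r.+1 ord_max e w.
  (* The covering gives [u] in [G] equivalent to [w] at rank [r.+1]; then [e] and [u] are equivalent
     at rank [r], and stability raises this to [r.+1]. *)
  move=> ew; have [u uw] := cov w; apply: (peq_trans _ uw); apply: stable.
  exact: peq_trans ew (peq_sym (peqS_peq uw)).
have lift i (e : {ffun 'I_l -> G}) (w : {ffun 'I_l -> H}) :
    peq r i e w -> peq r.+1 i e w.
  move=> ew; rewrite -[e](permuteK i ord_max) -[w](permuteK i ord_max).
  apply: peq_permute; rewrite tpermL; apply: lift_max.
  by apply: peq_permute; rewrite tpermR.
(* A constant tuple of [H] is covered at rank [r.+1]; one round is spent placing the last pebble,
   which yields a full position of rank [r]. *)
have /card_gt0P[b _] := vertex_gt0 H; have [u ub] := cov [ffun=> b].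
have [_ _ /(_ b)[a bis]] := peqSP _ _ _ _ ub.
apply: (@bisimilar_true_on l G H (@peq_all l r G H)) bis lphi => //.
- by move=> w w' /andP[].
- by move=> w w' i c /andP[_ /forallP/(_ i)/lift/peqSP[_ /(_ c)]].
- by move=> w w' i c /andP[_ /forallP/(_ i)/lift/peqSP[_ _ /(_ c)]].
Qed.

End Hintikka.

(** * Stabilisation *)

Section Stabilisation.
Variables (T : finType) (E : nat -> rel T).
Hypothesis E_equiv : forall r, equivalence_rel (E r).
Hypothesis E_sub : forall r, subrel (E r.+1) (E r).

Definition eclass r x : {set T} := [set y | E r x y].

Definition eclasses r : {set {set T}} := eclass r @: setT.

Lemma eq_eclass r x y : (eclass r x == eclass r y) = E r x y.
Proof.
apply/eqP/idP => [/setP/(_ y)|xy].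
  by rewrite !inE => ->; have [] := E_equiv r y y y.
by apply/setP => z; rewrite !inE; have [_ ->] := E_equiv r x y z.
Qed.

(** Coarsening maps the classes of level [r.+1] onto those of level [r]. With equal cardinals it
    would be injective, and [x], [y] could not be separated. *)
Lemma card_eclasses_lt r x y : E r x y -> ~~ E r.+1 x y ->
  #|eclasses r| < #|eclasses r.+1|.
Proof.
move=> xy nxy; pose coarsen (C : {set T}) := \bigcup_(z in C) eclass r z.
have coarsenE z : coarsen (eclass r.+1 z) = eclass r z.
  apply/setP => t; apply/bigcupP/idP => [[u]|zt].
    by rewrite !inE => /E_sub zu; have [_ ->] := E_equiv r z u t.
  by exists z => //; rewrite inE; have [] := E_equiv r.+1 z z z.
have -> : eclasses r = coarsen @: eclasses r.+1.
  by rewrite /eclasses -imset_comp; apply: eq_imset => z /=; rewrite coarsenE.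
rewrite ltn_neqAle leq_imset_card andbT; apply: contraNN nxy.
move/imset_injP => inj; rewrite -eq_eclass; apply/eqP.
by apply: inj; rewrite ?imset_f ?inE // !coarsenE; apply/eqP; rewrite eq_eclass.
Qed.

(** Every unstable level adds at least one class, so level [r] has [r + c] classes unless stability
    occurred earlier. *)
Lemma stable_level c M : c <= #|eclasses 0| -> (forall r, #|eclasses r| <= M) ->
  exists2 r, r + c <= M & forall x y, E r x y -> E r.+1 x y.
Proof.
move=> le_c le_M.
have grow r : (exists2 r', r' + c <= M & forall x y, E r' x y -> E r'.+1 x y) \/
    r + c <= #|eclasses r|.
  elim: r => [|r [|IHr]]; [by right | by left |].
  have [/forallP stab|] := boolP [forall x, forall y, E r x y ==> E r.+1 x y].
    left; exists r; first exact: leq_trans IHr (le_M r).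
    by move=> x y; apply/implyP; apply: (forallP (stab x)).
  case/forallPn => x /forallPn[y]; rewrite negb_imply => /andP[xy nxy].
  by right; rewrite addSn (leq_ltn_trans IHr) // (card_eclasses_lt xy).
have [//|h] := grow M.+1.
by have := leq_trans h (le_M _); rewrite addSn leqNgt ltnS leq_addr.
Qed.

End Stabilisation.

(** * Modules and the game with two pebbles *)

Definition is_module (G : graph) (S : {set G}) :=
  [forall v, (v \notin S) ==> [forall x in S, forall y in S, adj v x == adj v y]].

Lemma is_moduleP (G : graph) (S : {set G}) :
  reflect (forall v x y, v \notin S -> x \in S -> y \in S -> adj v x = adj v y)
          (is_module S).
Proof.
apply: (iffP forallP) => [h v x y vS xS yS|h v].
  by have /implyP/(_ vS)/forall_inP/(_ x xS)/forall_inP/(_ y yS)/eqP := h v.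
by apply/implyP => vS; apply/forall_inP => x xS; apply/forall_inP => y yS; apply/eqP/h.
Qed.

(* In a module of minimal size at least 2, removing a vertex which is isolated
   or dominating inside the module would leave a smaller module. *)
Lemma uniform_module (G : graph) : 1 < #|G| ->
  exists S : {set G}, [/\ 1 < #|S|, is_module S &
    forall a b x, a \in S -> b \in S -> x \in S -> x != a ->
      exists y, [/\ y \in S, y != b & adj b y = adj a x]].
Proof.
move=> n_gt1; pose P (S : {set G}) := (1 < #|S|) && is_module S.
have P_T : P setT.
  by rewrite /P cardsT n_gt1; apply/is_moduleP => v x y; rewrite inE.
case: (arg_minnP (fun S : {set G} => #|S|) P_T) => S /andP[S_gt1 modS] S_min.
exists S; split=> // a b x aS bS xS xa.
have [y /and3P[yS yb /eqP h]|no_y] :=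
  pickP [pred y | [&& y \in S, y != b & adj b y == adj a x]]; first by exists y.
have S_small : ~~ P (S :\ b).
  by apply/negP => /S_min; rewrite (cardsD1 b S) bS add1n ltnn.
(* By [no_y], [adj b y] is the negation of [adj a x] for every [y] in [S :\ b], so [b] does not
   separate these vertices. *)
have mod_b : is_module (S :\ b).
  apply/is_moduleP => v y z; rewrite !inE negb_and negbK => vSb /andP[yb yS] /andP[zb zS].
  have [->|vb] := eqVneq v b; last first.
    by rewrite (negPf vb) in vSb; apply: (is_moduleP _ modS).
  have := no_y y; have := no_y z; rewrite /= yS yb zS zb /=.
  by case: adj; case: adj; case: adj.
have card_b : #|S :\ b| <= 1 by move: S_small; rewrite /P mod_b andbT -leqNgt.
(* Since [S :\ b] has at most one element, the distinct vertices [a] and [x] cannot both differ from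
   [b]. *)
have [ab|ab] := eqVneq a b; first by exists x; rewrite -ab.
have [xb|xb] := eqVneq x b; first by exists a; rewrite xb adj_sym.
have : a = x by apply: (card_le1_eqP card_b); rewrite !inE ?ab ?xb.
by move/eqP; rewrite eq_sym (negPf xa).
Qed.

Section Twins.
Variables (G : graph) (S : {set G}).
Hypothesis modS : is_module S.
Hypothesis uniformS : forall a b x, a \in S -> b \in S -> x \in S -> x != a ->
  exists y, [/\ y \in S, y != b & adj b y = adj a x].

(** Identifies all vertices of [S]; two pebbles will not see the difference. *)
Let sim x y := (x == y) || (x \in S) && (y \in S).

Let sim_refl x : sim x x. Proof. by rewrite /sim eqxx. Qed.

Let sim_sym x y : sim x y = sim y x.
Proof. by rewrite /sim eq_sym andbC. Qed.

(** If [x] is outside [S], the module property allows the answer [x] itself; inside [S], uniformity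
    provides the answer. *)
Let sim_extend u u' x : sim u u' ->
  exists y, [/\ sim x y, adj u x = adj u' y & (u == x) = (u' == y)].
Proof.
case/orP=> [/eqP <-|/andP[uS u'S]]; first by exists x.
have [xS|xS] := boolP (x \in S); last first.
  exists x; split=> //; first by rewrite !(adj_sym _ x) (is_moduleP _ modS x u u').
  by rewrite (negPf (memPn xS _ uS)) (negPf (memPn xS _ u'S)).
have [->|xu] := eqVneq u x.
  by exists u'; rewrite /sim xS u'S orbT !adj_irr eqxx.
rewrite eq_sym in xu; have [y [yS yu' h]] := uniformS uS u'S xS xu.
by exists y; rewrite /sim xS yS orbT h eq_sym (negPf yu').
Qed.

Let ord2_neq (p q i : 'I_2) : p != i -> q != i -> p = q.
Proof.
by case: p q i => [[|[|p]] //= ?] [[|[|q]] //= ?] [[|[|i]] //= ?] // *; apply: val_inj.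
Qed.

(** With one of two pebbles lifted, a single vertex remains, and [sim_extend] keeps both pebbles
    [sim]-related after each move. Hence the relation survives any number of rounds. *)
Lemma module_peq r (i : 'I_2) (w w' : {ffun 'I_2 -> G}) :
  (forall j, j != i -> sim (w j) (w' j)) -> peq r i w w'.
Proof.
elim: r i w w' => [|r IHr] i w w' h.
  rewrite peq0E; apply/agreeP => p q; rewrite !inE => pi qi.
  by rewrite (ord2_neq pi qi) !adj_irr !eqxx.
have forth (u u' : {ffun 'I_2 -> G}) : (forall j, j != i -> sim (u j) (u' j)) ->
    forall a, exists b, peq_all r (update u i a) (update u' i b).
  move=> sim_u a; pose j := rev_ord i.
  have ji : j != i by rewrite /j; case: (i) => [[|[|]]].
  have [b [ab h_adj h_eq]] := sim_extend a (sim_u j ji).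
  exists b; apply/andP; split.
    apply/agreeP => p q _ _; rewrite !ffunE.
    case: (eqVneq p i) => [_|pi]; case: (eqVneq q i) => [_|qi].
    - by rewrite !adj_irr !eqxx.
    - by rewrite (ord2_neq qi ji) adj_sym h_adj adj_sym eq_sym h_eq eq_sym.
    - by rewrite (ord2_neq pi ji).
    - by rewrite (ord2_neq pi qi) !adj_irr !eqxx.
  apply/forallP => p; apply: IHr => q _; rewrite !ffunE.
  by case: eqVneq => // qi; apply: sim_u.
apply/peqSP; split=> [||b].
- apply/agreeP => p q; rewrite !inE => pi qi.
  by rewrite (ord2_neq pi qi) !adj_irr !eqxx.
- exact: forth.
have [|a /andP[ag /forallP pe]] := forth w' w _ b.
  by move=> j ji; rewrite sim_sym; apply: h.
exists a; rewrite /peq_all agree_sym ag; apply/forallP => j; exact: peq_sym.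
Qed.

End Twins.

(** The junk coordinate is fixed to [c] and the other one is either of two vertices of a uniform
    module. Keeping [m] with an equation avoids retyping the tuples at the point of use. *)
Lemma indiscernible_pair (G : graph) m (c : G) : 1 < #|G| -> m = 0 ->
  exists e e' : {ffun 'I_m.+2 -> G}, [/\ e != e', e ord_max = c, e' ord_max = c &
    forall r, peq r ord_max e e'].
Proof.
move=> n_gt1 ->; have [S [/card_gt1P[x [y [xS yS xy]]] modS uniS]] := uniform_module n_gt1.
pose w z : {ffun 'I_2 -> G} := [ffun j => if j == ord_max then c else z].
exists (w x), (w y); split; rewrite ?ffunE ?eqxx //.
  by apply: contraNneq xy => /ffunP/(_ ord0); rewrite !ffunE /= => ->.
move=> r; apply: (module_peq modS uniS) => j /negPf neq_j.
by rewrite !ffunE neq_j xS yS orbT.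
Qed.

(** * Counting the classes of tuples, and the rank at which they stabilise *)

Section StableRank.
Variables (m : nat) (G : graph).
Let l := m.+2.
Let E r : rel {ffun 'I_l -> G} := @peq l r G G ord_max.

Let E_equiv r : equivalence_rel (E r).
Proof.
move=> x y z; split; first exact: peq_refl.
move=> xy; apply/idP/idP; first exact: peq_trans (peq_sym xy).
exact: peq_trans xy.
Qed.

(** Representatives of the classes: the junk coordinate is normalised to [c], leaving [m.+1] free
    coordinates. *)
Let fixed_last c := [set w : {ffun 'I_l -> G} | w ord_max == c].

Let eclasses_fixed_last c r : eclasses E r = eclass E r @: fixed_last c.
Proof.
apply/setP => C; apply/imsetP/imsetP => -[w _ ->]; last by exists w.
exists (update w ord_max c); first by rewrite inE ffunE eqxx.
by apply/eqP; rewrite (eq_eclass E_equiv); apply/peq_sym/peq_update.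
Qed.

Let card_fixed_last c : #|fixed_last c| <= #|G| ^ m.+1.
Proof.
pose f (w : {ffun 'I_l -> G}) : {ffun 'I_m.+1 -> G} := [ffun j => w (lift ord_max j)].
have f_inj : {in fixed_last c &, injective f}.
  move=> w w'; rewrite !inE => /eqP wc /eqP w'c /ffunP eq_f; apply/ffunP => j.
  case: (unliftP ord_max j) => [k ->|->]; last by rewrite wc w'c.
  by have := eq_f k; rewrite !ffunE.
rewrite -(card_in_imset f_inj) (leq_trans (max_card _)) //.
by rewrite card_ffun card_ord.
Qed.

Lemma stable_rank : 1 < #|G| ->
  exists2 r, r + 2 <= #|G| ^ m.+1 &
    forall e e' : {ffun 'I_l -> G}, peq r ord_max e e' -> peq r.+1 ord_max e e'.
Proof.
move=> n_gt1; have /card_gt1P[a [b [_ _ ab]]] := n_gt1.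
have E_sub r : subrel (E r.+1) (E r) by move=> x y; apply: peqS_peq.
have le_card r : #|eclasses E r| <= #|G| ^ m.+1.
  by rewrite (eclasses_fixed_last a) (leq_trans (leq_imset_card _ _)).
have [m0|m_gt0] := posnP m.
  (* With two pebbles the count may start from a single class, but the indiscernible pair lowers the
     maximum by one, so the bound on [r] is the same. *)
  have lt_card r : #|eclasses E r| <= (#|G| ^ m.+1).-1.
    rewrite -ltnS prednK ?expn_gt0 ?(ltnW n_gt1) //.
    rewrite (eclasses_fixed_last a) (leq_trans _ (card_fixed_last a)) //.
    rewrite ltn_neqAle leq_imset_card andbT; apply/negP => /imset_injP inj.
    have [e [e' [neq_e ea e'a pe]]] := indiscernible_pair a n_gt1 m0.
    case/eqP: neq_e; apply: inj; rewrite ?inE ?ea ?e'a //.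
    by apply/eqP; rewrite (eq_eclass E_equiv); apply: pe.
  have [|r le_r stab] := @stable_level _ E E_equiv E_sub 1 _ _ lt_card.
    by apply/card_gt0P; exists (eclass E 0 [ffun=> a]); apply: imset_f.
  by exists r => //; rewrite addn2 -ltn_predRL -addn1.
have [|r le_r stab] := @stable_level _ E E_equiv E_sub 2 _ _ le_card; last by exists r.
(* Pebbles 0 and 1 are both on the board because [m > 0]; they coincide in [e] and differ in [e'],
   which gives two classes at rank 0. *)
pose e : {ffun 'I_l -> G} := [ffun=> a].
pose e' : {ffun 'I_l -> G} := [ffun j => if j == ord0 then a else b].
apply/card_gt1P; exists (eclass E 0 e), (eclass E 0 e'); rewrite !imset_f //.
split=> //; rewrite (eq_eclass E_equiv) /E peq0E.
have lt1 : 1 < l by []; have neq1 : Ordinal lt1 != ord_max.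
  by rewrite -(inj_eq val_inj) /= eqSS eq_sym -lt0n.
apply/negP => /agreeP/(_ ord0 (Ordinal lt1) _ neq1)[//|_].
by rewrite !ffunE eqxx (negPf ab).
Qed.

End StableRank.

(** * Characteristic sentences and the two depth bounds *)

Lemma characteristic_sentence (G : graph) m : ~ (#|G| = 1 /\ m = 0) ->
  exists phi, [/\ l_sentence m.+2 phi, true_on G phi,
    qdepth phi <= #|G| ^ (m.+2 - 1) + m.+2 - 2 &
    forall (H : graph) psi, true_on H phi -> l_sentence m.+2 psi ->
      true_on G psi -> true_on H psi].
Proof.
have [n_gt1 _|n_le1] := ltnP 1 #|G|.
  have [r le_r stab] := stable_rank m n_gt1.
  exists (covering m G r.+1); split.
  - exact: covering_l_sentence.
  - by apply/covering_true_on => w; exists w; apply: peq_refl.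
  (* The depth is at most [m.+1 + r.+1], that is [m + (r + 2)], and [r + 2] is at most
     [#|G| ^ m.+1]. *)
  - apply: leq_trans (qdepth_covering _ _ _) _; rewrite subn1 -addnBA // subn2 /=.
    by rewrite addSnnS addnC leq_add2r -addn2.
  - by move=> H psi; apply: covering_elementary.
have n1 : #|G| = 1 by apply/eqP; rewrite eqn_leq n_le1 vertex_gt0.
move=> nm; have {nm} m_gt0 : 0 < m by rewrite lt0n; apply/eqP => m0; apply: nm.
(* The bound is now [m.+1], and [m > 0] makes room for depth 2; the models are the one-vertex
   graphs, all isomorphic to [G]. *)
exists (close [:: 0; 1] (Eq 0 1)); split.
- by [].
- by apply/true_on_close => e /=; apply/eqP/(card_le1_eqP n_le1).
- by rewrite n1 exp1n add1n !subSS subn0 ltnS.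
move=> H psi /true_on_close H_le1; apply: isomorphic_true_on => //.
have /card_gt0P[a _] := vertex_gt0 G; have /card_gt0P[b _] := vertex_gt0 H.
have Gall x : x = a by apply: (card_le1_eqP n_le1).
have Hall x : x = b by have := H_le1 (fun y => if y == 0 then x else b) => /= /eqP.
exists (fun=> b); last by move=> x y; rewrite (Gall x) (Gall y) !adj_irr.
by exists (fun=> a) => x; rewrite ?(Gall x) ?(Hall x).
Qed.

(** An edgeless graph with one more vertex will do; against it, a definition of [G] becomes a
    distinguishing sentence. *)
Lemma ex_not_isomorphic (G : graph) : exists H : graph, ~ isomorphic G H.
Proof.
have gt0 : 0 < #|'I_#|G|.+1| by rewrite card_ord.
pose no_edge : rel 'I_#|G|.+1 := fun _ _ => false.
have no_edge_sym : symmetric no_edge by [].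
have no_edge_irr : irreflexive no_edge by [].
exists (Graph no_edge_sym no_edge_irr gt0) => -[f /bij_eq_card] /=.
by rewrite card_ord => /eqP; rewrite -[X in X == _]addn0 -addn1 eqn_add2l.
Qed.

Theorem theorem4p7 (G : graph) (n l : nat) (hn : #|G| = n) (hl : 0 < l)
    (hnl : ~ (n = 1 /\ l = 2)) :
  (forall H : graph, distinguishable l G H ->
     exists2 d, D_dist l G H d & d <= n ^ (l - 1) + l - 2) /\
  (definable l G ->
     exists2 d, D_def l G d & d <= n ^ (l - 1) + l - 2).
Proof.
case: l hl hnl => [//|[|m]] _ hnl.
  (* For [l = 1] both claims are vacuous. *)
  have no_dist H : ~ distinguishable 1 G H.
    by case=> phi lphi [Gphi]; apply; apply: one_variable_true_on Gphi.
  split=> [H /no_dist //|[phi lphi def_phi]].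
  have [H nH] := ex_not_isomorphic G.
  by case: (no_dist H); exists phi => //; apply: def_phi.
(* This one [phi] serves both claims: whatever [psi] refutes on [H], [phi] refutes too, since a
   model of [phi] would inherit [psi] from [G]. *)
have [|phi [lphi Gphi depth_phi charG]] := @characteristic_sentence G m.
  by case=> n1 m0; apply: hnl; rewrite -hn m0.
rewrite -hn; split=> [H [psi lpsi [Gpsi nHpsi]]|[psi lpsi def_psi]].
  have dist : l_sentence m.+2 phi /\ distinguishes phi G H.
    by split=> //; split=> // Hphi; apply: nHpsi; apply: charG Hphi lpsi Gpsi.
  have [d dP le_d] :=
    @is_min_qdepth_ex (fun f => l_sentence m.+2 f /\ distinguishes f G H) _ dist.
  by exists d => //; apply: leq_trans le_d depth_phi.
have def : l_sentence m.+2 phi /\ defines phi G.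
  split=> // H nH; have [Gpsi nHpsi] := def_psi H nH.
  by split=> // Hphi; apply: nHpsi; apply: charG Hphi lpsi Gpsi.
have [d dP le_d] :=
  @is_min_qdepth_ex (fun f => l_sentence m.+2 f /\ defines f G) _ def.
by exists d => //; apply: leq_trans le_d depth_phi.
Qed.
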